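(* Let $(G,w)$ be a weighted graph. The weight $w$ has a continuation to a pseudomultiplicative metric, i.e. there exists a pseudomultiplicative metric $d$ on $V(G)$ with $w(\{u,v\})=d(u,v)$ for all $\{u,v\}\in E(G)$, if and only if for every cycle $C\subseteq G$ and every edge $e\in E(C)$ the inequality $$w(e)\leqslant\prod_{\tilde e\in E(C)\setminus\{e\}}w(\tilde e)$$ holds and $w(e)\geqslant1$ for every $e\in E(G)$.
   Context: A graph $G=(V(G),E(G))$ is simple and may be finite or infinite, with $V(G)\neq\varnothing$; edges are two-element subsets of $V(G)$; cycles are finite and simple. A weighted graph $(G,w)$ is a graph $G$ together with a function $w\colon E(G)\to[0,\infty)$. A pseudomultiplicative metric on a nonempty set $X$ is a function $d\colon X\times X\to[1,\infty)$ such that for all $x,y,z\in X$: $d(x,x)=1$; $d(x,y)=d(y,x)$; $d(x,z)\leqslant d(x,y)\,d(y,z)$. *)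

(* Defs.v *)
From HB Require Import structures.
From mathcomp Require Import all_boot all_order all_algebra.
From mathcomp Require Import all_classical all_reals.

Set Implicit Arguments.
Unset Strict Implicit.
Unset Printing Implicit Defensive.
Import Order.TTheory GRing.Theory Num.Theory.
Local Open Scope classical_set_scope.
Local Open Scope ring_scope.

(* Vertices live in an ambient type T, so that a subgraph is again a graph
   over T. *)
Record graph (T : Type) := Graph {
  vertices : set T;
  edges : set (set T);
  vertices_nonempty : vertices !=set0;
  edges_pair : forall e, edges e -> exists u v,
    [/\ vertices u, vertices v, u <> v & e = [set u; v]] }.

Definition subgraph (T : Type) (H G : graph T) : Prop :=
  vertices H `<=` vertices G /\ edges H `<=` edges G.

(* [ordS i] is the cyclic successor i + 1 modulo n. *)
Definition is_cycle (T : Type) (C : graph T) : Prop :=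
  exists (n : nat) (x : 'I_n -> T),
    [/\ (3 <= n)%N, injective x, vertices C = range x
      & edges C = range (fun i : 'I_n => [set x i; x (ordS i)])].

(* Values of d outside X are unconstrained. *)
Definition pseudomultiplicative_metric (R : realType) (T : Type) (X : set T)
    (d : T -> T -> R) : Prop :=
  [/\ forall x y, X x -> X y -> 1 <= d x y,
      forall x, X x -> d x x = 1,
      forall x y, X x -> X y -> d x y = d y x
    & forall x y z, X x -> X y -> X z -> d x z <= d x y * d y z].

(* Main.v *)
Require Import Defs.
From HB Require Import structures.
From mathcomp Require Import all_boot all_order all_algebra.
From mathcomp Require Import all_classical all_reals.
Set Implicit Arguments.
Unset Strict Implicit.
Unset Printing Implicit Defensive.
Import Order.TTheory GRing.Theory Num.Theory.
Local Open Scope classical_set_scope.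
Local Open Scope ring_scope.

(** If [d] extends [w], then [w e = d u v] for [e = {u, v}], so [1 <= w e]; and
    going round a cycle from one end of [e] to the other, the triangle
    inequality bounds [d u v] by the product of the remaining weights
    ([metric_cycle_le]).

    Conversely, take for [d u v] the infimum of the products of weights along
    the walks from [u] to [v].  Concatenation of walks gives the triangle
    inequality, reversal gives symmetry, and [1 <= w] keeps all products, hence
    the infimum, at least [1].  On an edge [{u, v}] the infimum is at most
    [w {u, v}], as the edge is itself a walk.  It is not smaller
    ([edge_le_walk]): since the weights are at least [1], deleting the closed
    detours of a walk does not increase its product, so it suffices to compare
    with simple paths; and a simple path from [u] to [v] is either the edge
    itself or closes up with it to a cycle, where the hypothesis applies.

    No walk joins two different components, so distances between components
    must be invented.  Choosing a root in every component, one lets a walk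
    between components pass through the two roots, whose mutual distance is set
    to [1] ([glue_components]). *)

(** * Edges as unordered pairs *)

Lemma edge_neq (T : Type) (G : graph T) (u v : T) :
  edges G [set u; v] -> u <> v.
Proof.
move=> /edges_pair[a [b [_ _ ab Eab]]] uv; apply: ab.
rewrite -uv setUid in Eab.
have -> : a = u by have : [set u] a by rewrite Eab; left.
by have -> : b = u by have : [set u] b by rewrite Eab; right.
Qed.

Lemma edge_vertices (T : Type) (G : graph T) (u v : T) :
  edges G [set u; v] -> vertices G u /\ vertices G v.
Proof.
move=> /edges_pair[a [b [Va Vb _ Eab]]].
have sub z : [set u; v] z -> vertices G z by rewrite Eab => -[] ->.
by split; apply: sub; [left|right].
Qed.

Lemma set2_eqP (T : Type) (a b c d : T) :
  [set a; b] = [set c; d] -> (a = c /\ b = d) \/ (a = d /\ b = c).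
Proof.
move=> E.
have : [set c; d] a by rewrite -E; left.
have : [set c; d] b by rewrite -E; right.
have : [set a; b] c by rewrite E; left.
have : [set a; b] d by rewrite E; right.
by move=> [] /= + [] /= + [] /= + [] /= +; intuition congruence.
Qed.

(** * Edges of a cycle *)

Definition cyclic_edge (T : Type) (n : nat) (x : 'I_n -> T) (i : 'I_n) : set T :=
  [set x i; x (ordS i)].

Lemma ordS_neq (n : nat) (i : 'I_n.+2) : i <> ordS i.
Proof.
move=> /(congr1 val) /=; have := ltn_ord i; rewrite ltnS leq_eqVlt.
case/orP=> [/eqP ->|lti]; first by rewrite modnn.
by rewrite modn_small // => /n_Sn.
Qed.

Lemma ordSE (n : nat) (i : 'I_n.+2) : ordS i = i + 1.
Proof. by apply: val_inj; rewrite /= modnDmr addn1. Qed.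

Lemma ordS_max (n : nat) : ordS ord_max = ord0 :> 'I_n.+1.
Proof. by apply: val_inj; rewrite /= modnn. Qed.

Lemma ordS_widen (n : nat) (j : 'I_n) :
  ordS (widen_ord (leqnSn n) j) = lift ord0 j.
Proof.
by apply: val_inj; rewrite /= modn_small // ltnS; apply: ltn_ord.
Qed.

(** This is where length at least three matters: [E i = E j] with [i <> j] would
    force [i = j + 1] and [j = i + 1], hence [2 = 0] modulo the length. *)
Lemma cyclic_edge_inj (T : Type) (m : nat) (x : 'I_m.+3 -> T) :
  injective x -> injective (cyclic_edge x).
Proof.
move=> xI i j E; case: (set2_eqP E) => [[/xI //]|[/xI -> /xI]].
rewrite !ordSE -addrA -[RHS]addr0 => /addrI.
by move=> /(congr1 val) /=; rewrite !modn_small.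
Qed.

(** Turns the product over a set of edges into one along the path left when the
    closing edge is removed; distinct positions carry distinct edges, so no
    factor is lost. *)
Lemma prod_other_edges (R : realType) (T : Type) (m : nat) (x : 'I_m.+3 -> T)
    (F : set T -> R) : injective x ->
  \big[*%R/1]_(f \in range (cyclic_edge x) `\ cyclic_edge x ord_max) F f
  = \prod_(j < m.+2) F [set x (widen_ord (leqnSn _) j); x (lift ord0 j)].
Proof.
move=> /cyclic_edge_inj EI.
pose h (j : 'I_m.+2) := cyclic_edge x (widen_ord (leqnSn _) j).
have hE j : h j = [set x (widen_ord (leqnSn _) j); x (lift ord0 j)].
  by rewrite /h /cyclic_edge ordS_widen.
rewrite (@reindex_fsbig _ _ _ _ _ h setT); last first.
  split.
  - move=> j _ /=; split; first by exists (widen_ord (leqnSn _) j).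
    by move=> /EI /(congr1 val) /= jm; have := ltn_ord j; rewrite jm ltnn.
  - by move=> i j _ _ /EI /(congr1 val) /= ij; apply: val_inj.
  - move=> f [[i _ <-] ne].
    have lti : (i < m.+2)%N.
      rewrite ltn_neqAle -ltnS ltn_ord andbT; apply/eqP => im; apply: ne.
      by congr cyclic_edge; apply: val_inj.
    by exists (Ordinal lti) => //; congr cyclic_edge; apply: val_inj.
rewrite (fsbigE (index_enum 'I_m.+2)) ?index_enum_uniq //; last first.
  by move=> i _; rewrite mem_index_enum.
by apply: eq_big => [i|i _]; rewrite ?in_setT // -hE.
Qed.

(** The parametrization of a cycle can be rotated, so any given edge may be
    taken to be the closing one. *)
Lemma cycle_based_at_edge (T : Type) (C : graph T) (e : set T) :
  is_cycle C -> edges C e ->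
  exists m (x : 'I_m.+3 -> T), [/\ injective x, forall i, vertices C (x i),
    edges C = range (cyclic_edge x) & e = cyclic_edge x ord_max].
Proof.
move=> [[|[|[|m]]] [x [// _ xI VC EC]]]; rewrite EC => -[i _ <-].
(* The rotation takes the last index m + 2, which is -1, to i. *)
pose y (k : 'I_m.+3) := x (k + (i + 1)).
have yE k : cyclic_edge y k = cyclic_edge x (k + (i + 1)).
  by rewrite /cyclic_edge !ordSE /y addrAC.
exists m, y; split.
- by move=> j k /xI /addIr.
- by move=> k; rewrite VC; exists (k + (i + 1)).
- apply/seteqP; split=> f [k _ <-].
    by exists (k - (i + 1)) => //; rewrite yE subrK.
  by rewrite yE; exists (k + (i + 1)).
- rewrite yE; congr cyclic_edge.
  have max1 : ord_max + 1 = 0 :> 'I_m.+3 by rewrite -ordSE ordS_max.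
  by rewrite (addrC i) addrA max1 add0r.
Qed.

(** * Necessity of the cycle condition *)

Lemma metric_chain (R : realType) (T : Type) (X : set T) (d : T -> T -> R)
    (y : nat -> T) (n : nat) :
  pseudomultiplicative_metric X d -> (forall k, X (y k)) ->
  d (y 0%N) (y n) <= \prod_(j < n) d (y j) (y j.+1).
Proof.
move=> [d1 dxx _ dtri] Xy; elim: n => [|n IHn]; first by rewrite big_ord0 dxx.
rewrite big_ord_recr /=; apply: le_trans (dtri _ (y n) _ _ _ _) _ => //.
by rewrite ler_wpM2r // (le_trans ler01) // d1.
Qed.

Lemma metric_cycle_le (R : realType) (T : Type) (G C : graph T) (w : set T -> R)
    (d : T -> T -> R) (e : set T) :
  pseudomultiplicative_metric (vertices G) d ->
  (forall u v, edges G [set u; v] -> w [set u; v] = d u v) ->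
  is_cycle C -> subgraph C G -> edges C e ->
  w e <= \big[*%R/1]_(f \in edges C `\ e) w f.
Proof.
move=> dM wd cC [VCG ECG] eC.
have [m [x [xI VC EC ee]]] := cycle_based_at_edge cC eC.
have wE i : w (cyclic_edge x i) = d (x i) (x (ordS i)).
  by apply: wd; apply: ECG; rewrite EC; exists i.
have VG i : vertices G (x i) by exact: VCG.
rewrite EC ee prod_other_edges // wE ordS_max.
have [_ _ dsym _] := dM.
rewrite dsym //.
have := @metric_chain _ _ _ _ (fun k => x (inord k)) m.+2 dM (fun k => VG _).
rewrite (_ : inord 0 = ord0); last by apply: val_inj; rewrite /= inordK.
rewrite (_ : inord m.+2 = ord_max); last by apply: val_inj; rewrite /= inordK.
move=> /le_trans; apply; rewrite le_eqVlt; apply/orP; left; apply/eqP.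
apply: eq_bigr => j _.
have := wE (widen_ord (leqnSn _) j); rewrite /cyclic_edge ordS_widen => ->.
congr (d (x _) (x _)); apply: val_inj; rewrite /= inordK //.
  by rewrite ltnS ltnW.
by rewrite ltnS.
Qed.

(** * Walks and their weights *)

(** [walk G w u v] is the set of all products of weights along walks from [u] to
    [v]; keeping the values and not the walks lets the infimum be taken
    directly, and [u], [v] are connected when the set is nonempty. *)
Inductive walk (R : realType) (T : Type) (G : graph T) (w : set T -> R) :
    T -> T -> R -> Prop :=
| walk_nil u : walk G w u u 1
| walk_cons u v x a : edges G [set u; x] -> walk G w x v a ->
    walk G w u v (w [set u; x] * a).

Lemma walk_edge (R : realType) (T : Type) (G : graph T) (w : set T -> R) u v :
  edges G [set u; v] -> walk G w u v (w [set u; v]).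
Proof.
by move=> uv; rewrite -[w _]mulr1; apply: walk_cons => //; exact: walk_nil.
Qed.

Lemma walk_cat (R : realType) (T : Type) (G : graph T) (w : set T -> R)
    u v z a b :
  walk G w u v a -> walk G w v z b -> walk G w u z (a * b).
Proof.
elim=> [x|x y t c xt _ IH] vz; first by rewrite mul1r.
by rewrite -mulrA; apply: walk_cons => //; exact: IH.
Qed.

Lemma walk_rev (R : realType) (T : Type) (G : graph T) (w : set T -> R) u v a :
  walk G w u v a -> walk G w v u a.
Proof.
elim=> [x|x y t c xt _ IH]; first exact: walk_nil.
rewrite mulrC setUC; apply: (walk_cat IH); apply: walk_edge.
by rewrite setUC.
Qed.

Lemma walk_ge1 (R : realType) (T : Type) (G : graph T) (w : set T -> R) u v a :
  (forall e, edges G e -> 1 <= w e) -> walk G w u v a -> 1 <= a.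
Proof.
move=> w1; elim=> [//|x y t c xt _ IH].
by rewrite -[1]mulr1 ler_pM // w1.
Qed.

(** * Reduction of walks to simple paths *)

Fixpoint path_weight (R : realType) (T : Type) (w : set T -> R) (x : T)
    (p : seq T) : R :=
  if p is y :: q then w [set x; y] * path_weight w y q else 1.

Lemma path_weightE (R : realType) (T : Type) (w : set T -> R) (x0 x : T)
    (p : seq T) :
  path_weight w x p = \prod_(i < size p) w [set nth x0 (x :: p) i; nth x0 p i].
Proof.
elim: p x => [|y q IH] x /=; first by rewrite big_ord0.
by rewrite big_ord_recl /= IH; congr (_ * _); apply: eq_bigr.
Qed.

Definition adjacent (T : Type) (G : graph T) : rel T :=
  fun u v => `[< edges G [set u; v] >].

Lemma path_weight_ge1 (R : realType) (T : Type) (G : graph T) (w : set T -> R)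
    x p :
  (forall e, edges G e -> 1 <= w e) -> path (adjacent G) x p ->
  1 <= path_weight w x p.
Proof.
move=> w1; elim: p x => [//|y q IH] x /= /andP[/asboolP xy yq].
by rewrite -[leLHS]mulr1 ler_pM // ?w1 // IH.
Qed.

(** Cutting off an initial part of a path divides its weight by a product of
    factors at least [1]. *)
Lemma path_weight_suffix (R : realType) (T : eqType) (G : graph T)
    (w : set T -> R) u x p :
  (forall e, edges G e -> 1 <= w e) -> path (adjacent G) x p ->
  uniq (x :: p) -> u \in x :: p ->
  exists q, [/\ path (adjacent G) u q, uniq (u :: q), last u q = last x p
              & path_weight w u q <= path_weight w x p].
Proof.
move=> w1; elim: p x => [|y p IH] x.
  by move=> _ _; rewrite inE => /eqP ->; exists [::].
move=> xp xu; rewrite inE => /orP[/eqP ->|]; first by exists (y :: p).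
move: xp xu; rewrite /= => /andP[/asboolP xy yp] /andP[_ yu] uyp.
have [q [uq uu lq le]] := IH y yp yu uyp; exists q; split=> //.
apply: le_trans le _; rewrite -[leLHS]mul1r ler_wpM2r ?w1 //.
by rewrite (le_trans ler01) // (@path_weight_ge1 _ _ G).
Qed.

(** By induction on the walk: prepend its first vertex [x] to a simple path for
    the rest, or, if that path already visits [x], keep only its part from [x]
    on. *)
Lemma walk_simple (R : realType) (T : eqType) (G : graph T) (w : set T -> R)
    u v a :
  (forall e, edges G e -> 1 <= w e) -> walk G w u v a ->
  exists p, [/\ path (adjacent G) u p, uniq (u :: p), last u p = v
              & path_weight w u p <= a].
Proof.
move=> w1; elim=> [x|x y t c xt _ [p [tp up lp le]]];
  first by exists [::].
have w0 : 0 <= w [set x; t] by rewrite (le_trans ler01) // w1.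
have le' : w [set x; t] * path_weight w t p <= w [set x; t] * c.
  by rewrite ler_wpM2l.
have [xtp|xtp] := boolP (x \in t :: p); last first.
  exists (t :: p); split=> //; last by rewrite /= xtp.
  by rewrite /=; apply/andP; split=> //; apply/asboolP.
have [q [xq uq lq leq]] := path_weight_suffix w1 tp up xtp.
exists q; split=> //; first by rewrite lq.
apply: le_trans leq (le_trans _ le'); rewrite -[leLHS]mul1r ler_wpM2r ?w1 //.
by rewrite (le_trans ler01) // (@path_weight_ge1 _ _ G).
Qed.

Lemma cyclic_graph (T : Type) (m : nat) (x : 'I_m.+3 -> T) : injective x ->
  exists C : graph T, vertices C = range x /\ edges C = range (cyclic_edge x).
Proof.
move=> xI.
have ne : range x !=set0 by exists (x ord0), ord0.
have ep e : range (cyclic_edge x) e -> exists u v,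
    [/\ range x u, range x v, u <> v & e = [set u; v]].
  move=> [i _ <-]; exists (x i), (x (ordS i)); split=> //.
  by move=> /xI; exact: ordS_neq.
by exists (Graph ne ep).
Qed.

(** The cycle condition gives exactly this comparison, which says that passing
    to the infimum over walks does not shorten an edge. *)
Lemma edge_le_walk (R : realType) (T : eqType) (G : graph T) (w : set T -> R)
    u v a :
  (forall C, is_cycle C -> subgraph C G -> forall e, edges C e ->
     w e <= \big[*%R/1]_(f \in edges C `\ e) w f) ->
  (forall e, edges G e -> 1 <= w e) ->
  edges G [set u; v] -> walk G w u v a -> w [set u; v] <= a.
Proof.
move=> wC w1 uv /(walk_simple w1)[p [up pU lp le]]; apply: le_trans le.
case: p up pU lp => [|y1 [|y2 q]].
- by move=> _ _ /= vu; case: (edge_neq uv).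
- by move=> _ _ /= ->; rewrite mulr1.
(* The path has at least three vertices, and {u, v} closes it to a cycle. *)
set p := y1 :: _ => up pU lp.
pose x (i : 'I_(size q).+3) := nth u (u :: p) i.
have xI : injective x.
  by move=> i j /eqP; rewrite nth_uniq // => /eqP ij; apply: val_inj.
have e_max : cyclic_edge x ord_max = [set u; v].
  by rewrite /cyclic_edge ordS_max setUC -lp (last_nth u).
have [C [VC EC]] := cyclic_graph xI.
have EG : edges C `<=` edges G.
  rewrite EC => f [i _ <-].
  have [->|im] := eqVneq i ord_max; first by rewrite e_max.
  have lti : (i < size p)%N.
    by rewrite ltn_neqAle -ltnS ltn_ord andbT.
  have /asboolP := pathP u up i lti.
  by rewrite /cyclic_edge /x /= modn_small.
have CG : subgraph C G.
  split=> // t; rewrite VC => -[i _ <-].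
  have xiG : edges G (cyclic_edge x i) by apply: EG; rewrite EC; exists i.
  by have [] := edge_vertices xiG.
have cC : is_cycle C by exists (size q).+3, x.
have Ce : edges C [set u; v] by rewrite EC -e_max; exists ord_max.
apply: le_trans (wC C cC CG _ Ce) _.
rewrite EC -e_max prod_other_edges // (path_weightE _ u) le_eqVlt.
by apply/orP; left; apply/eqP; apply: eq_bigr.
Qed.

(** * Gluing the components and the infimum metric *)

(** With [h x] the distance from [x] to the root of its component, points of
    different components get distance [h x * h y].  The mixed triangle
    inequalities reduce to [h x <= rho x y * h y] and
    [rho x y <= h x * h y] inside a component. *)
Lemma glue_components (R : realType) (T : choiceType) (t0 : T)
    (conn : T -> T -> Prop) (rho : T -> T -> R) :
  (forall x, conn x x) -> (forall x y, conn x y -> conn y x) ->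
  (forall x y z, conn x y -> conn y z -> conn x z) ->
  (forall x y, conn x y -> 1 <= rho x y) -> (forall x, rho x x = 1) ->
  (forall x y, rho x y = rho y x) ->
  (forall x y z, conn x y -> conn y z -> rho x z <= rho x y * rho y z) ->
  exists d : T -> T -> R, pseudomultiplicative_metric setT d /\
    forall x y, conn x y -> d x y = rho x y.
Proof.
move=> cxx csym ctr rho1 rhoxx rhosym rhotr.
pose r x := xget t0 (conn x).
have cr x : conn x (r x) by apply: xgetPex; exists x.
have rE x y : conn x y -> r x = r y.
  move=> xy; congr xget; apply/seteqP; split=> z; last exact: ctr.
  by apply: ctr; exact: csym.
pose h x := rho x (r x).
have h1 x : 1 <= h x by exact: rho1.
have h0 x : 0 <= h x by apply: le_trans (h1 x).
have hle x y : conn x y -> h x <= rho x y * h y.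
  by move=> xy; rewrite /h (rE _ _ xy); apply: rhotr.
have rhole x y : conn x y -> rho x y <= h x * h y.
  move=> xy; rewrite {1}/h /h (rE _ _ xy) (rhosym y).
  by apply: rhotr; rewrite -?(rE _ _ xy) //; apply: csym; rewrite (rE _ _ xy).
pose d x y := if `[< conn x y >] then rho x y else h x * h y.
have dE x y : conn x y -> d x y = rho x y by move=> xy; rewrite /d asboolT.
have dN x y : ~ conn x y -> d x y = h x * h y by move=> xy; rewrite /d asboolF.
exists d; split=> //; split=> [x y _ _|x _|x y _ _|x y z _ _ _].
- have [xy|xy] := pselect (conn x y); first by rewrite dE // rho1.
  by rewrite dN // -[1]mulr1 ler_pM.
- by rewrite dE.
- have [xy|xy] := pselect (conn x y); first by rewrite !dE //; exact: csym.
  by rewrite !dN 1?mulrC // => /csym.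
have [xy|xy] := pselect (conn x y); have [yz|yz] := pselect (conn y z).
- by rewrite !dE //; [exact: rhotr|exact: ctr yz].
- rewrite (dE x y) // !dN //; first by rewrite mulrA ler_wpM2r ?hle.
  by move=> xz; apply: yz; apply: ctr xz; exact: csym.
- rewrite (dE y z) // !dN //; last first.
    by move=> xz; apply: xy; apply: ctr xz _; exact: csym.
  by rewrite -mulrA ler_wpM2l // mulrC rhosym hle //; exact: csym.
- have hxz : h x * h z <= h x * h y * (h y * h z).
    rewrite mulrA ler_wpM2r // -mulrA -[leLHS]mulr1 ler_wpM2l //.
    by rewrite -[1]mulr1 ler_pM.
  rewrite (dN x y) // (dN y z) //; apply: le_trans hxz.
  by have [xz|xz] := pselect (conn x z); [rewrite dE // rhole|rewrite dN].
Qed.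

(** Each triangle inequality between infima is obtained by dividing: for fixed
    [a] in one set of walk weights, [inf / a] is a lower bound of the other. *)
Lemma walk_inf_metric (R : realType) (T : choiceType) (G : graph T)
    (w : set T -> R) : (forall e, edges G e -> 1 <= w e) ->
  exists d : T -> T -> R, pseudomultiplicative_metric setT d /\
    forall u v, walk G w u v !=set0 -> d u v = inf (walk G w u v).
Proof.
move=> w1; have [t0 _] := vertices_nonempty G.
have lb u v : lbound (walk G w u v) 1 by move=> a /(walk_ge1 w1).
have le u v a : walk G w u v a -> inf (walk G w u v) <= a.
  by move=> ?; apply: ge_inf => //; exists 1; exact: lb.
apply: (glue_components t0) => [u|u v|u v z|u v|u|u v|u v z].
- by exists 1; exact: walk_nil.
- by move=> [a ua]; exists a; exact: walk_rev.
- by move=> [a ua] [b vb]; exists (a * b); exact: walk_cat vb.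
- by move=> uv; apply: lb_le_inf.
- have uu := walk_nil G w u.
  by apply/eqP; rewrite eq_le le // lb_le_inf //; exists 1.
- by congr inf; apply/seteqP; split=> a; exact: walk_rev.
- move=> uv vz.
  have b0 b : 1 <= b -> 0 < b by exact: lt_le_trans.
  have vz0 : 0 < inf (walk G w v z) by apply: b0; apply: lb_le_inf.
  rewrite -ler_pdivrMr //; apply: lb_le_inf => // a ua.
  have a0 : 0 < a by apply: b0; exact: lb ua.
  rewrite ler_pdivrMr // mulrC -ler_pdivrMr //; apply: lb_le_inf => // b vb.
  by rewrite ler_pdivrMr // mulrC; apply: le; exact: walk_cat vb.
Qed.

Lemma cycle_condition_extends (R : realType) (T : choiceType) (G : graph T)
    (w : set T -> R) :
  (forall C, is_cycle C -> subgraph C G -> forall e, edges C e ->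
     w e <= \big[*%R/1]_(f \in edges C `\ e) w f) ->
  (forall e, edges G e -> 1 <= w e) ->
  exists d : T -> T -> R, pseudomultiplicative_metric (vertices G) d /\
    forall u v, edges G [set u; v] -> w [set u; v] = d u v.
Proof.
move=> wC w1; have [d [[d1 dxx dsym dtri] dE]] := walk_inf_metric w1.
exists d; split.
  by split=> *; [exact: d1|exact: dxx|exact: dsym|exact: dtri].
move=> u v uv; have uvw := walk_edge w uv.
have ne : walk G w u v !=set0 by exists (w [set u; v]).
rewrite dE //; apply/eqP; rewrite eq_le; apply/andP; split.
  by apply: lb_le_inf => // a; exact: edge_le_walk.
by apply: ge_inf uvw; exists 1 => a /(walk_ge1 w1).
Qed.

Theorem corollary4p6 (R : realType) (T : Type) (G : graph T)
    (w : {fun edges G >-> `[0 : R, +oo[%classic}) :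
  (exists d : T -> T -> R,
     pseudomultiplicative_metric (vertices G) d /\
     forall u v : T, edges G [set u; v] -> w [set u; v] = d u v)
  <->
  ((forall C : graph T, is_cycle C -> subgraph C G ->
      forall e : set T, edges C e ->
        w e <= \big[*%R/1]_(f \in edges C `\ e) w f) /\
   (forall e : set T, edges G e -> 1 <= w e)).
Proof.
split=> [[d [dM wd]]|[wC w1]].
  split=> [C cC CG e|e eG]; first exact: metric_cycle_le dM wd cC CG.
  have [u [v [Vu Vv _ ee]]] := edges_pair eG.
  by have [d1 _ _ _] := dM; rewrite ee wd -?ee // d1.
(* Deleting detours tests whether a vertex was visited and roots are chosen, so
   the vertices are given classical equality and choice. *)
exact: (@cycle_condition_extends R {classic T} G w wC w1).
Qed.
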